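(* Let $\alpha\in(0,1]$ and let $\mathbf E=(E^S_t)$ be a dynamic intersection $e$-process collection that is future-extension coherent and time-monotone. Then: (a) the candidate process $(\mathfrak R_{\alpha,t}(\mathbf E))_{t\ge0}$ controls simultaneous SupFDR: for every $P\in\mathcal M$, $$\mathbb E_P\Big[\sup_{t\ge0}\ \max_{R\in\mathfrak R_{\alpha,t}(\mathbf E)}\mathrm{FDP}_{\mathcal N(P)}(R)\Big]\le\alpha;$$ (b) the candidate families are setwise persistent: pointwise on $\Omega$, $R\in\mathfrak R_{\alpha,t}(\mathbf E)$ and $u\ge t$ imply $R\in\mathfrak R_{\alpha,u}(\mathbf E)$.
   Context: Let $(\Omega,\mathcal F,(\mathcal F_t)_{t\in\mathbb N_0})$ be a discrete-time filtered measurable space, $\mathcal M$ a family of probability measures on $(\Omega,\mathcal F)$, $\mathcal I\subseteq\mathbb N$ an index set (finite or infinite), and $H_i\subseteq\mathcal M$, $i\in\mathcal I$, null hypotheses. Put $\mathcal N(P)=\{i\in\mathcal I:P\in H_i\}$ and, for finite $S\subseteq\mathcal I$, $H_S=\bigcap_{i\in S}H_i$ (with $H_\varnothing=\mathcal M$). The active sets $I_t\subseteq\mathcal I$ are deterministic and finite with $I_0\subseteq I_1\subseteq\cdots$ and $\bigcup_t I_t=\mathcal I$. For a finite $R\subseteq\mathcal I$ and any $S\subseteq\mathcal I$, $\mathrm{FDP}_S(R)=|S\cap R|/(|R|\vee 1)$. A nonnegative $(\mathcal F_t)$-adapted process $E=(E_t)_{t\ge0}$ is an $e$-process for $H\subseteq\mathcal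 M$ if $\mathbb E_P[E_\tau]\le1$ for every $P\in H$ and every $(\mathcal F_t)$-stopping time $\tau$ with $P(\tau<\infty)=1$. A dynamic intersection $e$-process collection is a family $\mathbf E=(E^S_t)_{t\ge0,\ S\subseteq\mathcal I,\ 0<|S|<\infty}$ such that $E^S=(E^S_t)_{t\ge0}$ is an $e$-process for $H_S$ for each nonempty finite $S$. It is future-extension coherent if, pointwise on $\Omega$, $E_t^{S\cap I_t}\le E_t^S$ for every $t$ and every finite $S$ with $S\cap I_t\ne\varnothing$. It is time-monotone if, pointwise on $\Omega$, $E^S_t\le E^S_u$ for all $t\le u$ and every finite nonempty $S$. The closure family at time $t$ is $\mathfrak R_{\alpha,t}(\mathbf E)=\{R\subseteq I_t:\ \mathrm{FDP}_S(R)\le\alpha E^S_t\text{ for every nonempty }S\subseteq I_t\}$. *)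

(* Defs.v *)
From HB Require Import structures.
From mathcomp Require Import all_boot all_order all_algebra finmap.
From mathcomp Require Import all_classical all_reals all_analysis.
From mathcomp Require Import measurable_realfun.

Set Implicit Arguments.
Unset Strict Implicit.
Unset Printing Implicit Defensive.

Import Order.TTheory GRing.Theory Num.Theory.
Import numFieldNormedType.Exports.

Local Open Scope classical_set_scope.
Local Open Scope ring_scope.

Definition filtration (d : measure_display) (T : measurableType d)
    (F : nat -> set (set T)) : Prop :=
  [/\ forall t, sigma_algebra setT (F t),
      forall t, F t `<=` measurable &
      forall s t, (s <= t)%N -> F s `<=` F t].

Definition adapted (d : measure_display) (T : measurableType d) (R : realType)
    (F : nat -> set (set T)) (X : nat -> T -> \bar R) : Prop :=
  forall t (B : set (\bar R)), measurable B -> F t (X t @^-1` B).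

(* A random time takes values in [option nat], [None] being the value
   infinity. *)
Definition stopping_time (T : Type) (F : nat -> set (set T))
    (tau : T -> option nat) : Prop :=
  forall t, F t [set w | exists2 s, tau w = Some s & (s <= t)%N].

(* The value 0 on [tau = None] is immaterial: the stopping times below are
   almost surely finite. *)
Definition stopped (T : Type) (R : realType) (X : nat -> T -> \bar R)
    (tau : T -> option nat) (w : T) : \bar R :=
  if tau w is Some t then X t w else 0%E.

(* Processes are allowed to take the value +oo; finite-valued processes are
   the special case of functions with values in the image of [%:E]. *)
Definition e_process (d : measure_display) (T : measurableType d)
    (R : realType) (F : nat -> set (set T)) (H : set (probability T R))
    (X : nat -> T -> \bar R) : Prop :=
  [/\ forall t w, (0 <= X t w)%E,
      adapted F X &
      forall P : probability T R, H P -> forall tau : T -> option nat,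
        stopping_time F tau -> P [set w | tau w <> None] = 1%E ->
        (\int[P]_w stopped X tau w <= 1)%E].

Definition true_nulls (d : measure_display) (T : measurableType d)
    (R : realType) (I : set nat) (H : nat -> set (probability T R))
    (P : probability T R) : set nat :=
  [set i | I i /\ H i P].

Definition inter_null (d : measure_display) (T : measurableType d)
    (R : realType) (M : set (probability T R))
    (H : nat -> set (probability T R)) (S : {fset nat}) :
    set (probability T R) :=
  [set P | M P /\ forall i, i \in S -> H i P].

Definition active_sets (I : set nat) (act : nat -> {fset nat}) : Prop :=
  (forall s t, (s <= t)%N -> (act s `<=` act t)%fset) /\
  \bigcup_t [set` act t] = I.

Definition FDP (R : realType) (S : set nat) (A : {fset nat}) : R :=
  #|` [fset i in A | i \in S]%fset|%:R / (maxn #|` A| 1)%:R.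

(* [E S t w] is only constrained for nonempty S included in I. *)
Definition intersection_e_collection (d : measure_display)
    (T : measurableType d) (R : realType) (F : nat -> set (set T))
    (M : set (probability T R)) (I : set nat)
    (H : nat -> set (probability T R))
    (E : {fset nat} -> nat -> T -> \bar R) : Prop :=
  forall S : {fset nat}, S != fset0 -> [set` S] `<=` I ->
    e_process F (inter_null M H S) (E S).

Definition future_extension_coherent (T : Type) (R : realType) (I : set nat)
    (act : nat -> {fset nat}) (E : {fset nat} -> nat -> T -> \bar R) : Prop :=
  forall (w : T) (t : nat) (S : {fset nat}), [set` S] `<=` I ->
    (S `&` act t)%fset != fset0 ->
    (E (S `&` act t)%fset t w <= E S t w)%E.

Definition time_monotone (T : Type) (R : realType) (I : set nat)
    (E : {fset nat} -> nat -> T -> \bar R) : Prop :=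
  forall (w : T) (t u : nat) (S : {fset nat}), (t <= u)%N ->
    S != fset0 -> [set` S] `<=` I -> (E S t w <= E S u w)%E.

Definition closure_family (T : Type) (R : realType) (act : nat -> {fset nat})
    (alpha : R) (E : {fset nat} -> nat -> T -> \bar R) (t : nat) (w : T) :
    set {fset nat} :=
  [set A | (A `<=` act t)%fset /\
    forall S : {fset nat}, S != fset0 -> (S `<=` act t)%fset ->
      ((FDP R [set` S] A)%:E <= alpha%:E * E S t w)%E].

(* The inner supremum is a maximum for candidate families that are nonempty
   and finite; the closure family is both, as it contains the empty set and
   consists of subsets of the active set. *)
Definition sup_FDP (T : Type) (R : realType)
    (C : nat -> T -> set {fset nat}) (S : set nat) (w : T) : \bar R :=
  ereal_sup [set ereal_sup [set (FDP R S A)%:E | A in C t w] | t in setT].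

(* The measurability clause makes the expectation meaningful: the integral of
   a nonnegative nonmeasurable function is only a lower integral. *)
Definition controls_SupFDR (d : measure_display) (T : measurableType d)
    (R : realType) (M : set (probability T R)) (I : set nat)
    (H : nat -> set (probability T R)) (alpha : R)
    (C : nat -> T -> set {fset nat}) : Prop :=
  forall P : probability T R, M P ->
    measurable_fun setT (sup_FDP R C (true_nulls I H P)) /\
    (\int[P]_w sup_FDP R C (true_nulls I H P) w <= alpha%:E)%E.

Definition setwise_persistent (T : Type) (C : nat -> T -> set {fset nat}) :
    Prop :=
  forall (w : T) (t u : nat) (A : {fset nat}), (t <= u)%N ->
    C t w A -> C u w A.

(* Main.v *)
Require Import Defs.
From mathcomp Require Import all_boot all_order all_algebra finmap.
From mathcomp Require Import all_classical all_reals all_analysis.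
From mathcomp Require Import measurable_realfun.

(** Persistence (b) is checked one index set at a time: a nonempty [S] in the
    later active set either misses [act t], and then its proportion in any
    candidate set of time [t] vanishes, or it has the same proportion as
    [S `&` act t], and then the bound known at time [t] climbs to the pair
    [(S, u)] through coherence (from [S `&` act t] to [S] at time [t]) and
    monotonicity (from [t] to [u]). This is [closure_family_persistent].

    For (a), fix [P], let [N] be the possibly infinite set of its true nulls,
    and let [g t] be the largest proportion of [N] over the candidate sets of
    time [t]. Candidate sets at time [t] lie in [act t], so only the finite
    part [N `&` act t] matters. If it is empty, [g t] vanishes; otherwise the
    closure condition at that part gives
    [g t <= alpha * E (N `&` act t) t] pointwise ([sup_FDP_closure_le]). The
    right-hand side has expectation at most [alpha], since the constant [t] is
    a stopping time and [P] lies in the intersection null of [N `&` act t].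
    By (b) the candidate families grow with [t], hence so does [g t]: the
    supremum over time is a nondecreasing limit, and monotone convergence
    carries the bound [alpha] to it. *)

Set Implicit Arguments.
Unset Strict Implicit.
Unset Printing Implicit Defensive.

Import Order.TTheory GRing.Theory Num.Theory.

Local Open Scope classical_set_scope.
Local Open Scope ring_scope.

(** * The false discovery proportion *)

Lemma FDP_eq0 (R : realType) (S : set nat) (A : {fset nat}) :
  {in A, forall i, ~ S i} -> FDP R S A = 0.
Proof.
move=> AS; rewrite /FDP [X in #|` X|](_ : _ = fset0) ?cardfs0 ?mul0r//.
apply/fsetP => i; rewrite !inE /=; apply/negP => /andP[/AS nSi].
by rewrite in_setE.
Qed.

(** The denominator does not involve [S], so the proportion sees [S] only
    through its trace on [A]. This is what lets a null set be replaced by its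
    intersection with an active set. *)
Lemma eq_FDP_in (R : realType) (S S' : set nat) (A : {fset nat}) :
  {in A, forall i, S i <-> S' i} -> FDP R S A = FDP R S' A.
Proof.
move=> SS'; rewrite /FDP; congr (_%:R / _); congr #|` _ |.
apply/fsetP => i; rewrite !inE; apply: andb_id2l => iA.
by apply/idP/idP; rewrite !in_setE => /SS'; exact.
Qed.

Lemma FDP_fsetI (R : realType) (S A B : {fset nat}) : (A `<=` B)%fset ->
  FDP R [set` (S `&` B)%fset] A = FDP R [set` S] A.
Proof.
move=> /fsubsetP AB; apply: eq_FDP_in => i /AB iB /=.
by rewrite inE iB andbT.
Qed.

(** * Measurability of suprema over random families *)

(** Countability of the index type is what makes this work: the supremum
    exceeds [x] exactly when one of the countably many indices [j] with
    [x < f j] belongs to the random set. *)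
Lemma measurable_ereal_sup_random_set (d : measure_display)
    (T : measurableType d) (R : realType) (J : countType) (f : J -> \bar R)
    (C : T -> set J) :
  (forall j, measurable [set w | C w j]) ->
  measurable_fun setT (fun w => ereal_sup [set f j | j in C w]).
Proof.
move=> mC mT; apply: (measurability _ (ErealGenOInfty.measurableE R)) => //.
move=> _ [_ [x ->] <-]; rewrite setTI.
rewrite [X in measurable X](_ : _ =
    \bigcup_j ([set w | C w j] `&` [set _ | (x%:E < f j)%E])).
  apply: countable_bigcupT_measurable => // j.
  have [xf|xf] := boolP (x%:E < f j)%E.
    rewrite [X in _ `&` X](_ : _ = setT) ?setIT//.
    by apply/seteqP; split.
  rewrite [X in _ `&` X](_ : _ = set0) ?setI0//.
  by apply/seteqP; split=> // w /=; rewrite (negbTE xf).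
apply/seteqP; split=> w /=; rewrite in_itv/= andbT.
  by move=> /ereal_sup_gt[_ [j Cj <-] xj]; exists j.
move=> [j _ [/= Cj xj]]; apply: (lt_le_trans xj).
by apply: ereal_sup_ubound; exists j.
Qed.

(** Only the finitely many [S] inside [act t] constrain [A], so the event is a
    finite intersection of comparisons between measurable functions. *)
Lemma measurable_closure_event (d : measure_display) (T : measurableType d)
    (R : realType) (act : nat -> {fset nat}) (alpha : R)
    (E : {fset nat} -> nat -> T -> \bar R) (t : nat) (A : {fset nat}) :
  (forall S : {fset nat}, S != fset0 -> (S `<=` act t)%fset ->
    measurable_fun setT (E S t)) ->
  measurable [set w | closure_family act alpha E t w A].
Proof.
move=> mE.
have [At|At] := boolP (A `<=` act t)%fset; last first.
  rewrite [X in measurable X](_ : _ = set0)//.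
  by apply/seteqP; split=> // w [] /=; rewrite (negbTE At).
pose D := [set S : {fset nat} | S != fset0 /\ (S `<=` act t)%fset].
rewrite [X in measurable X](_ : _ =
  \bigcap_(S in D) [set w | ((FDP R [set` S] A)%:E <= alpha%:E * E S t w)%E]).
  apply: fin_bigcap_measurable => [|S [S0 St]].
    apply: (@sub_finite_set _ _ [set` fpowerset (act t)]) => //.
    by move=> S [_ St] /=; rewrite fpowersetE.
  rewrite -[X in measurable X]setTI; apply: measurable_lee => //.
  by apply: measurable_funeM; exact: mE.
apply/seteqP; split=> w /=.
  by move=> [_ h] S [S0 St]; exact: h.
by move=> h; split=> // S S0 St; exact: (h S).
Qed.

(** * E-processes at deterministic times *)

Lemma filtration0T (d : measure_display) (T : measurableType d)
    (F : nat -> set (set T)) (t : nat) :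
  filtration F -> F t set0 /\ F t setT.
Proof.
move=> [/(_ t)[F0 FC _] _ _]; split=> //.
by rewrite -[setT]setD0; exact: FC.
Qed.

Lemma e_process_measurable (d : measure_display) (T : measurableType d)
    (R : realType) (F : nat -> set (set T)) (H : set (probability T R))
    (X : nat -> T -> \bar R) (t : nat) :
  filtration F -> e_process F H X -> measurable_fun setT (X t).
Proof.
move=> [_ FT _] [_ adX _] _ B mB; rewrite setTI.
exact/(FT t)/adX.
Qed.

(** A constant time is a stopping time, being at most [s] either everywhere or
    nowhere. *)
Lemma e_process_expectation_le1 (d : measure_display) (T : measurableType d)
    (R : realType) (F : nat -> set (set T)) (H : set (probability T R))
    (X : nat -> T -> \bar R) (P : probability T R) (t : nat) :
  filtration F -> e_process F H X -> H P -> (\int[P]_w X t w <= 1)%E.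
Proof.
move=> Ff [_ _ /(_ P)] /[apply] /(_ (fun=> Some t)); apply.
- move=> s; have [F0 FT] := filtration0T s Ff.
  have [ts|st] := leqP t s.
    rewrite [X in F s X](_ : _ = setT)//.
    by apply/seteqP; split=> // w _; exists t.
  rewrite [X in F s X](_ : _ = set0)//.
  by apply/seteqP; split=> // w [u [<-]]; rewrite leqNgt st.
- rewrite [X in P X](_ : _ = setT) ?probability_setT//.
  by apply/seteqP; split.
Qed.

(** * The closure family *)

Section closure_family.
Variables (T : Type) (R : realType) (I : set nat) (act : nat -> {fset nat}).
Variables (alpha : R) (E : {fset nat} -> nat -> T -> \bar R).
Hypothesis act_active : active_sets I act.
Hypothesis alpha_ge0 : 0 <= alpha.
Hypothesis E_ge0 : forall S : {fset nat}, S != fset0 -> [set` S] `<=` I ->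
  forall t w, (0 <= E S t w)%E.

Lemma active_sub (S : {fset nat}) t : (S `<=` act t)%fset -> [set` S] `<=` I.
Proof.
move=> /fsubsetP St i /= /St it; case: act_active => _ <-.
by exists t.
Qed.

(** Nonemptiness keeps the supremum of the proportions nonnegative: over an
    empty family it would be minus infinity. *)
Lemma closure_family_fset0 t w : closure_family act alpha E t w fset0.
Proof.
split=> [|S S0 St]; first exact: fsub0set.
by rewrite FDP_eq0// mule_ge0 ?lee_fin// E_ge0//; exact: active_sub St.
Qed.

(** Coherence compares index sets at a fixed time, monotonicity compares times
    at a fixed index set; together they take the bound from
    [(S `&` act t, t)] to [(S, u)]. *)
Lemma closure_family_persistent :
  future_extension_coherent I act E -> time_monotone I E ->
  setwise_persistent (closure_family act alpha E).
Proof.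
move=> Ecoh Emon w t u A tu [At clA].
have [act_mono _] := act_active.
split; first exact: fsubset_trans At (act_mono _ _ tu).
move=> S S0 Su; have SI := active_sub Su.
rewrite -(FDP_fsetI R S At).
have [->|St0] := eqVneq (S `&` act t)%fset fset0.
  by rewrite FDP_eq0// mule_ge0 ?lee_fin// E_ge0.
apply: (le_trans (clA _ St0 (fsubsetIr _ _))).
by rewrite lee_wpmul2l ?lee_fin// (le_trans (Ecoh w t S SI St0))// Emon.
Qed.

(** The closure condition quantifies over finite index sets only; it applies to
    an infinite [N] because candidate sets of time [t] see [N] through its
    part in [act t]. *)
Lemma sup_FDP_closure_le (N : set nat) t w :
  let S := [fset i in act t | i \in N]%fset in S != fset0 ->
  (ereal_sup [set (FDP R N A)%:E | A in closure_family act alpha E t w] <=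
   alpha%:E * E S t w)%E.
Proof.
move=> S S0; apply: ge_ereal_sup => _ [A [/fsubsetP At clA] <-].
rewrite (@eq_FDP_in R N [set` S]); last first.
  move=> i /At iA; rewrite /S /= !inE /= iA.
  by split=> [/mem_set|/set_mem].
by apply: clA => //; apply/fsubsetP => i; rewrite !inE => /andP[].
Qed.

End closure_family.

Theorem theorem3p7 (d : measure_display) (T : measurableType d) (R : realType)
    (F : nat -> set (set T)) (M : set (probability T R)) (I : set nat)
    (H : nat -> set (probability T R)) (act : nat -> {fset nat})
    (alpha : R) (E : {fset nat} -> nat -> T -> \bar R)
    (F_filtration : filtration F)
    (H_sub_M : forall i, I i -> H i `<=` M)
    (act_active : active_sets I act)
    (alpha_gt0 : 0 < alpha) (alpha_le1 : alpha <= 1)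
    (E_coll : intersection_e_collection F M I H E)
    (E_coherent : future_extension_coherent I act E)
    (E_monotone : time_monotone I E) :
  controls_SupFDR M I H alpha (closure_family act alpha E) /\
  setwise_persistent (closure_family act alpha E).
Proof.
have E_ge0 (S : {fset nat}) : S != fset0 -> [set` S] `<=` I ->
    forall t w, (0 <= E S t w)%E.
  by move=> S0 SI; case: (E_coll S S0 SI).
have alpha_ge0 := ltW alpha_gt0.
have persistent : setwise_persistent (closure_family act alpha E).
  exact: (closure_family_persistent act_active).
split=> // P MP.
set N := true_nulls I H P.
pose g t w :=
  ereal_sup [set (FDP R N A)%:E | A in closure_family act alpha E t w].
have mE (S : {fset nat}) t : S != fset0 -> (S `<=` act t)%fset ->
    measurable_fun setT (E S t).
  move=> S0 St; have SI := active_sub act_active St.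
  exact: e_process_measurable F_filtration (E_coll S S0 SI).
have mg t : measurable_fun setT (g t).
  apply: measurable_ereal_sup_random_set => A.
  by apply: measurable_closure_event => S; exact: mE.
have g_ge0 t w : (0 <= g t w)%E.
  apply: ereal_sup_ubound; exists fset0; last by rewrite FDP_eq0.
  exact: closure_family_fset0 act_active _ E_ge0 _ _.
have g_homo w : {homo g ^~ w : m n / (m <= n)%N >-> (m <= n)%E}.
  move=> m n mn; apply: ereal_sup_le => _ [A clA <-].
  by exists A => //; exact: persistent clA.
have g_cvg w : g ^~ w @ \oo --> sup_FDP R (closure_family act alpha E) N w.
  exact: ereal_nondecreasing_cvgn.
have int_g_le t : (\int[P]_w g t w <= alpha%:E)%E.
  pose S := [fset i in act t | i \in N]%fset.
  have [S0|S0] := eqVneq S fset0.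
    (* No true null is active yet, so every proportion is zero. *)
    rewrite integral0_eq ?lee_fin// => w _.
    apply/eqP; rewrite eq_le g_ge0 andbT.
    apply: ge_ereal_sup => _ [A [/fsubsetP At _] <-].
    rewrite FDP_eq0// => i /At it /mem_set iN.
    by move/fsetP : S0 => /(_ i); rewrite !inE /= it iN.
  have St : (S `<=` act t)%fset by apply/fsubsetP => i; rewrite !inE => /andP[].
  have SI := active_sub act_active St.
  have nullS : inter_null M H S P.
    by split=> // i; rewrite !inE /= => /andP[_ /set_mem[]].
  have := e_process_expectation_le1 t F_filtration (E_coll S S0 SI) nullS.
  move=> /(lee_wpmul2l (_ : 0 <= alpha%:E)%E); rewrite mule1 lee_fin.
  move=> /(_ alpha_ge0); apply: le_trans.
  rewrite -(ge0_integralZl P measurableT (mE S t S0 St)) ?lee_fin//; last first.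
    by move=> w _; exact: E_ge0.
  apply: ge0_le_integral => //.
    by apply: measurable_funeM; exact: mE.
  by move=> w _; exact: sup_FDP_closure_le.
split.
  by apply: (emeasurable_fun_cvg g) => // w _; exact: g_cvg.
have cvg_int := @cvg_monotone_convergence _ _ _ P _ measurableT g mg
  (fun t w _ => g_ge0 t w) (fun w _ => g_homo w).
rewrite (eq_integral (fun w => limn (g ^~ w))); last first.
  by move=> w _; rewrite (cvg_lim _ (g_cvg w)).
rewrite -(cvg_lim _ cvg_int)//; apply: lime_le.
  exact: cvgP cvg_int.
exact: nearW.
Qed.
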